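(* Let $\alpha>1$ be an integer and let $a$ be any integer such that \[ a>-\frac{\alpha^{2/3}}{1+\alpha^{1/3}}. \] For $n\ge 0$ set \[ a_n=\sum_{\substack{i,j\ge 0\\ 2i+3j\le n}}(-1)^i\binom{i+j}{j}\binom{n-i-2j}{i+j}(3a)^{n-2i-3j}(3a^{2}-3\alpha)^i\,(a^3+\alpha-3a\alpha+\alpha^{2})^j . \] Then \[ \lim_{n\to\infty}\left(1+\frac{\alpha-1}{\dfrac{a_n}{a_{n-1}}-a+1}\right)=\alpha^{1/3}. \] *)

(* Defs.v *)
From mathcomp Require Import all_boot all_order all_algebra.
From mathcomp Require Import all_classical all_reals all_analysis.
Set Implicit Arguments.
Unset Strict Implicit.
Unset Printing Implicit Defensive.
Import Order.TTheory GRing.Theory Num.Theory.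
Local Open Scope ring_scope.

(* The bounds [i, j < n.+1] lose nothing, since 2i + 3j <= n forces i, j <= n,
   and the truncated subtractions on exponents and binomials are exact there. *)
Definition a_seq (alpha a : int) (n : nat) : int :=
  \sum_(i < n.+1) \sum_(j < n.+1 | (2 * i + 3 * j <= n)%N)
    (-1) ^+ i * 'C(i + j, j)%:Z * 'C(n - i - 2 * j, i + j)%:Z
    * (3 * a) ^+ (n - 2 * i - 3 * j)
    * (3 * a ^+ 2 - 3 * alpha) ^+ i
    * (a ^+ 3 + alpha - 3 * a * alpha + alpha ^+ 2) ^+ j.

(* Main.v *)
(* By the multinomial theorem [a_n] is the coefficient of [X^n] in the power series
   [1 / (1 - p X + q X^2 - r X^3)], with [p], [q], [r] the three quantities raised to
   powers in its definition. So it satisfies the linear recurrence with characteristic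
   polynomial [X^3 - p X^2 + q X - r = (X - a)^3 - 3 alpha (X - a) - alpha - alpha^2].
   With [t = alpha^(1/3)] its real root is [l = a + t + t^2], and the two others are
   complex conjugates; the lower bound on [a] says exactly that [l] has larger modulus
   than these. Hence [a_n / a_(n-1)] tends to [l], and
   [1 + (t^3 - 1) / (t + t^2 + 1) = t]. *)
Require Import Defs.
From mathcomp Require Import all_boot all_order all_algebra.
From mathcomp Require Import all_classical all_reals all_analysis.
From mathcomp Require Import ring lra zify.
Import Order.TTheory GRing.Theory Num.Theory.
Import numFieldNormedType.Exports.
Local Open Scope classical_set_scope.
Local Open Scope ring_scope.

(** This is [p X - q X^2 + r X^3], nested so that its powers expand by two successive uses of the
    binomial theorem. *)
Definition trinom_step {A : comNzRingType} (p q r : A) : {poly A} :=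
  'X * (p%:P + 'X * (r *: 'X - q%:P)).

(* The coefficient of [X^n] in the geometric series [1 / (1 - U)], [U = trinom_step p q r];
   the terms with [m > n] do not contribute since ['X] divides [U]. *)
Definition trinom_sum {A : comNzRingType} (p q r : A) (n : nat) : A :=
  \sum_(m < n.+1) (trinom_step p q r ^+ m)`_n.

Lemma trinom_sum_widen {A : comNzRingType} (p q r : A) (n N : nat) : (n < N)%N ->
  \sum_(m < N) (trinom_step p q r ^+ m)`_n = trinom_sum p q r n.
Proof.
move=> nN; rewrite /trinom_sum.
rewrite (big_ord_widen N (fun m => (trinom_step p q r ^+ m)`_n) nN).
rewrite [RHS]big_mkcond; apply: eq_bigr => m _.
rewrite ltnS; case: leqP => // nm.
by rewrite /trinom_step exprMn coefXnM nm.
Qed.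

(** The series [S = 1 / (1 - U)] satisfies [S = 1 + U S], and in degree [n + 3] the constant drops
    out. *)
Lemma trinom_sum_rec {A : comNzRingType} (p q r : A) (n : nat) :
  trinom_sum p q r n.+3 = p * trinom_sum p q r n.+2 - q * trinom_sum p q r n.+1
    + r * trinom_sum p q r n.
Proof.
rewrite {1}/trinom_sum big_ord_recl expr0 coef1 add0r.
rewrite -!(@trinom_sum_widen _ p q r _ n.+3); [|lia..].
rewrite !mulr_sumr -sumrB -big_split; apply: eq_bigr => m _ /=.
set V := trinom_step p q r ^+ m.
rewrite /bump /= add1n exprS -/V /trinom_step -mulrA coefXM /= mulrDl coefD coefCM.
rewrite -mulrA coefXM /= mulrBl coefB coefCM -scalerAl coefZ coefXM /=.
by ring.
Qed.

Lemma trinom_sum0 {A : comNzRingType} (p q r : A) : trinom_sum p q r 0 = 1.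
Proof. by rewrite /trinom_sum big_ord1 expr0 coef1. Qed.

Lemma trinom_sum1 {A : comNzRingType} (p q r : A) : trinom_sum p q r 1 = p.
Proof.
rewrite /trinom_sum !big_ord_recl big_ord0 expr0 expr1 coef1.
by rewrite /trinom_step coefXM /= coefD coefC coefXM /= !(add0r, addr0).
Qed.

Lemma trinom_sum2 {A : comNzRingType} (p q r : A) : trinom_sum p q r 2 = p ^+ 2 - q.
Proof.
rewrite /trinom_sum !big_ord_recr big_ord0 /= expr0 expr1 coef1 [trinom_step _ _ _ ^+ 2]expr2.
rewrite {2}/trinom_step -mulrA /trinom_step !coefXM /= mulrDl.
rewrite !coefD !coefCM !coefXM -?mulrA /=.
by rewrite !coefXM !coefD !coefC !coefXM /= coefN coefZ coefX coefC mulrCA coefXM /=; ring.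
Qed.

Lemma rmorph_trinom_sum {A B : comNzRingType} (f : {rmorphism A -> B})
    (p q r : A) (n : nat) :
  f (trinom_sum p q r n) = trinom_sum (f p) (f q) (f r) n.
Proof.
rewrite /trinom_sum rmorph_sum; apply: eq_bigr => m _; rewrite -coef_map rmorphXn /=.
by rewrite /trinom_step !(rmorphM, rmorphD, rmorphN) /= map_polyZ !map_polyX !map_polyC.
Qed.

(** Among the [m] factors, [l] avoid [p X] and [j] of these pick [r X^3], which gives degree
    [m + l + j]. Both ranges depend on [n] alone, so that sums can be exchanged later. *)
Lemma coef_trinom_stepX {A : comNzRingType} (p q r : A) (m n : nat) :
  (trinom_step p q r ^+ m)`_n =
  \sum_(l < n.+1) \sum_(j < n.+1 | m + l + j == n)
    (- q) ^+ (l - j) * p ^+ (m - l) * r ^+ j * ('C(m, l) * 'C(l, j))%:R.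
Proof.
have expand (B : comNzRingType) (x y : B) (k N : nat) : (k <= N)%N ->
    (x + y) ^+ k = \sum_(i < N.+1) x ^+ (k - i) * y ^+ i *+ 'C(k, i).
  move=> kN; rewrite exprDn.
  rewrite (big_ord_widen N.+1 (fun i => x ^+ (k - i) * y ^+ i *+ 'C(k, i))) ?ltnS//.
  rewrite big_mkcond; apply: eq_bigr => i _; rewrite ltnS.
  by case: leqP => // ki; rewrite bin_small.
have [nm|mn] := ltnP n m.
  rewrite /trinom_step exprMn coefXnM nm big1 // => l _; rewrite big1 // => j /eqP; lia.
rewrite /trinom_step exprMn (expand _ _ _ _ _ mn) mulr_sumr coef_sum.
apply: eq_bigr => l _; have ln : (l <= n)%N by rewrite -ltnS.
rewrite (addrC (r *: 'X)) exprMn (expand _ _ _ _ _ ln) !mulr_sumr mulrnAr !mulr_sumr -sumrMnl.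
rewrite coef_sum [RHS]big_mkcond; apply: eq_bigr => j _ /=.
rewrite -polyCN -!polyC_exp exprZn.
rewrite (_ : _ *+ _ = ((- q) ^+ (l - j) * p ^+ (m - l) * r ^+ j
                        * ('C(m, l) * 'C(l, j))%:R) *: 'X^(m + l + j)).
  by rewrite coefZ coefXn eq_sym; case: eqP => _; rewrite ?mulr1 ?mulr0.
rewrite -!mul_polyC [in RHS]mulr_natr !(mulrnAr, polyCMn, mulrnAl) -mulrnA mulnC.
by rewrite !polyCM !exprD; congr (_ *+ _); ring.
Qed.

Lemma trinom_sumE {A : comNzRingType} (p q r : A) (n : nat) :
  trinom_sum p q r n =
  \sum_(i < n.+1) \sum_(j < n.+1 | (2 * i + 3 * j <= n)%N)
    (-1) ^+ i * 'C(i + j, j)%:R * 'C(n - i - 2 * j, i + j)%:R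
    * p ^+ (n - 2 * i - 3 * j) * q ^+ i * r ^+ j.
Proof.
rewrite /trinom_sum; under eq_bigr do rewrite coef_trinom_stepX.
pose f m l j := (- q) ^+ (l - j) * p ^+ (m - l) * r ^+ j * ('C(m, l) * 'C(l, j))%:R.
(* The degree condition forces [m = n - l - j]. *)
transitivity (\sum_(j < n.+1) \sum_(0 <= l < n.+1 | (l + j <= n)%N) f (n - l - j)%N l j).
  rewrite exchange_big /=; under eq_bigr do rewrite (exchange_big_dep xpredT)//=.
  rewrite exchange_big /=; apply: eq_bigr => j _.
  rewrite big_mkord [RHS]big_mkcond; apply: eq_bigr => l _.
  case: leqP => ljn; last by rewrite big1 // => m /eqP; lia.
  have mP : (n - l - j < n.+1)%N by lia.
  rewrite (big_pred1 (Ordinal mP)) // => m /=.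
  by rewrite -val_eqE /=; lia.
rewrite [RHS](exchange_big_dep xpredT) //=; apply: eq_bigr => j _.
(* Terms with [l < j] vanish through ['C(l, j)]; the others are reindexed by [l = i + j]. *)
rewrite (big_cat_nat (n := j)) //=; last by rewrite ltnW.
rewrite big_nat_cond big1 ?add0r; last first.
  by move=> l /andP[/andP[_ lj] _]; rewrite /f (@bin_small l j)// muln0 mulr0.
rewrite -{1}[nat_of_ord j]add0n big_addn (big_nat_widen _ _ n.+1) ?leq_subr//.
rewrite big_mkord big_mkcond [RHS]big_mkcond; apply: eq_bigr => i _ /=.
have -> : (i + j + j <= n)%N && (i < n.+1 - j)%N = (i + 2 * j <= n)%N by lia.
rewrite /f addnK (_ : n - (i + j) - j = n - i - 2 * j)%N; last by lia.
rewrite (_ : n - i - 2 * j - (i + j) = n - 2 * i - 3 * j)%N; last by lia.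
case: (leqP (2 * i + 3 * j) n) => h.
  rewrite (_ : (i + 2 * j <= n)%N = true); last by lia.
  rewrite -[- q]mulN1r exprMn natrM; ring.
(* Here [n < 2i + 3j], so [n - i - 2j < i + j] and the binomial is zero. *)
case: ifP => // _; rewrite (@bin_small (n - i - 2 * j)); last by lia.
by rewrite mul0n mulr0.
Qed.

Lemma a_seqE (alpha a : int) (n : nat) :
  a_seq alpha a n = trinom_sum (3 * a) (3 * a ^+ 2 - 3 * alpha)
    (a ^+ 3 + alpha - 3 * a * alpha + alpha ^+ 2) n.
Proof.
rewrite trinom_sumE /a_seq; apply: eq_bigr => i _; apply: eq_bigr => j _.
by rewrite !natz.
Qed.

Lemma sqr_le_geometric_cvg0 {R : realType} (u : nat -> R) (K rho : R) :
  0 <= rho < 1 -> (forall n, u n ^+ 2 <= K * rho ^+ n) -> u @ \oo --> 0.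
Proof.
move=> /andP[rho0 rho1] uK; apply/norm_cvg0P.
have u2 : (fun n => u n ^+ 2) @ \oo --> (0 : R).
  apply: (@squeeze_cvgr _ _ _ _ (fun=> 0) (fun n => K * rho ^+ n)).
  - by near=> n; rewrite sqr_ge0 uK.
  - exact: cvg_cst.
  - rewrite -(mulr0 K); apply: cvgM; first exact: cvg_cst.
    by apply: cvg_expr; rewrite ger0_norm.
rewrite -sqrtr0; under eq_fun do rewrite -sqrtr_sqr.
exact: continuous_cvg (@sqrt_continuous R 0) u2.
Unshelve. all: by end_near. Qed.

(* The characteristic polynomial is [(X - l) (X^2 - b X + c)], whose quadratic
   factor has complex conjugate roots of modulus [sqrt c]. *)
Lemma linrec3_ratio_cvg {R : realType} (l b c : R) (x : nat -> R) :
  0 < l -> b ^+ 2 < 4 * c -> c < l ^+ 2 ->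
  (forall n, x n.+3 = (l + b) * x n.+2 - (c + l * b) * x n.+1 + l * c * x n) ->
  x 2 - b * x 1 + c * x 0 != 0 ->
  (fun n => x n.+1 / x n) @ \oo --> l.
Proof.
move=> l0 bc cl xrec; set v0 := (X in X != 0) => v00.
have lN0 : l != 0 by rewrite gt_eqF.
(* Applying [X - l] removes the [l^n] mode and leaves the recurrence of the quadratic factor. *)
pose u n := x n.+1 - l * x n.
have urec n : u n.+2 = b * u n.+1 - c * u n by rewrite /u xrec; ring.
(* The energy [u_(n+1)^2 - b u_(n+1) u_n + c u_n^2] is multiplied by [c] at each step. *)
pose E0 := u 1 ^+ 2 - b * u 1 * u 0 + c * u 0 ^+ 2.
have uE n : u n.+1 ^+ 2 - b * u n.+1 * u n + c * u n ^+ 2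
    = E0 * c ^+ n.
  elim: n => [|n IH]; first by rewrite expr0 mulr1.
  by rewrite urec [c ^+ n.+1]exprSr [RHS]mulrA -IH; ring.
(* By completing the square, the energy is at least [(c - b^2 / 4) u_n^2]. *)
have d0 : 0 < c - b ^+ 2 / 4 by lra.
have u2 n : u n ^+ 2 <= E0 / (c - b ^+ 2 / 4) * c ^+ n.
  rewrite mulrAC ler_pdivlMr// -uE -subr_ge0.
  rewrite (_ : _ - _ = (u n.+1 - b / 2 * u n) ^+ 2) ?sqr_ge0//.
  by field.
(* Applying the quadratic factor instead leaves only the [l^n] mode. *)
have vE n : x n.+2 - b * x n.+1 + c * x n = v0 * l ^+ n.
  elim: n => [|n IH]; first by rewrite expr0 mulr1.
  by rewrite xrec [l ^+ n.+1]exprSr [RHS]mulrA -IH; ring.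
have D0 : 0 < l ^+ 2 - b * l + c.
  by have := sqr_ge0 (l - b / 2); rewrite sqrrB; nra.
have ul : (fun n => u n / l ^+ n) @ \oo --> (0 : R).
  apply: (@sqr_le_geometric_cvg0 _ _ (E0 / (c - b ^+ 2 / 4)) (c / l ^+ 2)).
    rewrite ltr_pdivrMr ?exprn_gt0// mul1r cl andbT divr_ge0 ?sqr_ge0//.
    by have := sqr_ge0 b; lra.
  move=> n; rewrite !expr_div_n mulrA -!exprM mulnC ler_pM2r ?u2//.
  by rewrite invr_gt0 exprn_gt0.
pose y n := x n / l ^+ n.
have yl : y @ \oo --> v0 / (l ^+ 2 - b * l + c).
  (* Divide [v0 l^n = u_(n+1) + (l - b) u_n + (l^2 - b l + c) x_n] by [l^n]. *)
  have -> : y = (fun n =>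
     (v0 - (l - b) * (u n / l ^+ n) - l * (u n.+1 / l ^+ n.+1))
       / (l ^+ 2 - b * l + c)).
    apply/funext => n; rewrite /y.
    have ln0 : l ^+ n != 0 by rewrite expf_neq0.
    have -> : v0 = (x n.+2 - b * x n.+1 + c * x n) / l ^+ n by rewrite vE mulfK.
    rewrite /u exprS; field.
    by rewrite lN0 ln0 gt_eqF.
  rewrite -[in X in _ --> X](subr0 v0) -[in X in _ --> X](subr0 (v0 - 0)).
  rewrite -[X in v0 - X - _](mulr0 (l - b)) -[X in _ - _ - X](mulr0 l).
  apply: cvgM; last exact: cvg_cst.
  apply: cvgB; first apply: cvgB; first exact: cvg_cst.
    by apply: cvgM; [exact: cvg_cst | exact: ul].
  apply: cvgM; first exact: cvg_cst.
  by move: ul; rewrite -(cvg_shiftS (fun n => u n / l ^+ n)).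
have L0 : v0 / (l ^+ 2 - b * l + c) != 0.
  by rewrite mulf_neq0 // invr_neq0 // gt_eqF.
have -> : (fun n => x n.+1 / x n) = (fun n => l * y n.+1 / y n).
  apply/funext => n; rewrite /y exprS.
  have ln0 : l ^+ n != 0 by rewrite expf_neq0.
  (* Only powers of [l] are cancelled, so the identity holds even where [x n] is zero, with inverse
     0. *)
  rewrite [RHS](_ : _ = (l / l) * (l ^+ n / l ^+ n) * (x n.+1 / x n)).
    by rewrite !divff// !mul1r.
  by rewrite !invfM invrK; ring.
rewrite -[X in _ --> X](mulfK L0).
apply: cvgM; last exact: cvgV.
apply: cvgM; first exact: cvg_cst.
by move: yl; rewrite -(cvg_shiftS y).
Qed.

Lemma a_seq_ratio_cvg {R : realType} (alpha a : int) (t : R) :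
  t ^+ 3 = alpha%:~R -> 1 < t -> 0 < a%:~R * (1 + t) + t ^+ 2 ->
  (fun n => (a_seq alpha a n.+1)%:~R / (a_seq alpha a n)%:~R)
    @ \oo --> a%:~R + t + t ^+ 2.
Proof.
move=> t3E t1; set A : R := a%:~R => ha.
have xE n : (a_seq alpha a n)%:~R = trinom_sum (3 * A) (3 * A ^+ 2 - 3 * t ^+ 3)
    (A ^+ 3 + t ^+ 3 - 3 * A * t ^+ 3 + (t ^+ 3) ^+ 2) n.
  rewrite a_seqE (rmorph_trinom_sum (intmul 1)) /= t3E /A.
  by congr trinom_sum; ring.
under eq_fun do rewrite !xE.
(* With [w] a primitive cube root of unity, these are the sum and product of the roots
   [A + w t + w^2 t^2] and its conjugate. *)
apply: (@linrec3_ratio_cvg _ _ (2 * A - t - t ^+ 2)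
  (A ^+ 2 - A * (t + t ^+ 2) + (t + t ^+ 2) ^+ 2 - 3 * t ^+ 3)
  (trinom_sum (3 * A) _ _)).
- rewrite -(@pmulr_lgt0 _ (1 + t)); last by lra.
  by nra.
(* [4 c - b^2 = 3 (t (t - 1))^2]. *)
- have : 0 < (t * (t - 1)) ^+ 2 by rewrite exprn_gt0// mulr_gt0; lra.
  lra.
(* [l^2 - c = 3 t (A (1 + t) + t^2)]. *)
- have : 0 < t * (A * (1 + t) + t ^+ 2) by rewrite mulr_gt0//; lra.
  lra.
- by move=> n; rewrite trinom_sum_rec; ring.
- rewrite trinom_sum0 trinom_sum1 trinom_sum2.
  rewrite [X in X != 0](_ : _ = (A + t + t ^+ 2) ^+ 2); last by ring.
  by rewrite expf_neq0// gt_eqF//; nra.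
Qed.

Theorem theorem2 (R : realType) (alpha a : int) (halpha : 1 < alpha)
    (ha : - (((alpha%:~R : R) `^ (2 / 3)) / (1 + (alpha%:~R : R) `^ (1 / 3)))
          < a%:~R) :
  (fun n : nat =>
     1 + (alpha%:~R - 1) /
         ((a_seq alpha a n)%:~R / (a_seq alpha a n.-1)%:~R - a%:~R + 1) : R)
    @ \oo --> (alpha%:~R : R) `^ (1 / 3).
Proof.
have A0 : 0 <= alpha%:~R :> R by rewrite ler0z; lia.
have t2E : (alpha%:~R : R) `^ (2 / 3) = ((alpha%:~R : R) `^ (1 / 3)) ^+ 2.
  rewrite -powR_mulrn ?powR_ge0// -powRrM; congr (_ `^ _); by field.
have t3E : ((alpha%:~R : R) `^ (1 / 3)) ^+ 3 = alpha%:~R.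
  by rewrite -powR_mulrn ?powR_ge0// -powRrM mulfVK// powRr1.
rewrite t2E in ha; move: ha t3E (powR_ge0 (alpha%:~R : R) (1 / 3)).
set t := _ `^ (1 / 3) => ha t3E t0.
have t1 : 1 < t.
  rewrite ltNge; apply/negP => t1.
  have : t ^+ 3 <= 1 by rewrite exprn_ile1.
  by rewrite t3E leNgt ltr1z halpha.
have {}ha : 0 < a%:~R * (1 + t) + t ^+ 2.
  move: ha; rewrite -mulNr ltr_pdivrMr; last by lra.
  by rewrite -subr_gt0 opprK.
have xl := a_seq_ratio_cvg _ _ _ t3E t1 ha.
set A : R := a%:~R in ha xl *.
pose x n : R := (a_seq alpha a n)%:~R.
pose g n : R := 1 + (alpha%:~R - 1) / (x n.+1 / x n - A + 1).
(* Shifting the index drops [n = 0], where [n.-1] is truncated to 0. *)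
suff : g @ \oo --> t.
  by rewrite -(cvg_shiftS (fun n => 1 + (alpha%:~R - 1) / (x n / x n.-1 - A + 1))).
have D0 : A + t + t ^+ 2 - A + 1 != 0 by rewrite gt_eqF//; nra.
have -> : t = 1 + (alpha%:~R - 1) / (A + t + t ^+ 2 - A + 1).
  by rewrite -t3E; field.
apply: cvgD; first exact: cvg_cst.
apply: cvgM; first exact: cvg_cst.
apply: cvgV => //.
apply: cvgD; last exact: cvg_cst.
by apply: cvgB; last exact: cvg_cst.
Qed.
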